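(* A poset is simplicial if and only if it is isomorphic to a subcomplex of a simplex.
   Context: Posets may be of any cardinality. For a set $S$ (possibly infinite), the simplex $\Delta^S$ is the poset of all nonempty subsets of $S$ ordered by inclusion. A subcomplex of a simplex is a closed subposet, i.e. a subposet $Q$ of $\Delta^S$ such that $p\le q\in Q$ implies $p\in Q$. The cone of an element $p$ of a poset $P$ is the subposet $\lceil p\rceil=\{q\in P: q\le p\}$. A poset $P$ is conditionally complete if every nonempty subset of $P$ that has an upper bound in $P$ has a least upper bound in $P$. A simplicial poset is a conditionally complete poset in which every cone is isomorphic (as a poset) to a simplex $\Delta^S$ for some set $S$. *)

(* Defs.v *)
From HB Require Import structures.
From mathcomp Require Import all_boot all_order all_classical.
Set Implicit Arguments.
Unset Strict Implicit.
Unset Printing Implicit Defensive.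
Import Order.TTheory.
Local Open Scope order_scope.
Local Open Scope classical_set_scope.

(* Every type carries a choiceType structure classically (gen_choiceMixin), so
   porderType is no restriction on the posets considered. *)

Definition subposet (d : Order.disp_t) (T : porderType d) (A : set T) : Type :=
  set_type A.

HB.instance Definition _ (d : Order.disp_t) (T : porderType d) (A : set T) :=
  SubChoice.on (subposet A).
HB.instance Definition _ (d : Order.disp_t) (T : porderType d) (A : set T) :=
  [SubChoice_isSubPOrder of subposet A by <: with d].

(* The order on set S is inclusion (subsetEset). *)
Definition simplex (S : Type) : Type := subposet [set A : set S | A !=set0].

HB.instance Definition _ (S : Type) := Order.POrder.on (simplex S).

Definition closed_subposet (d : Order.disp_t) (T : porderType d) (Q : set T) :
    Prop :=
  forall p q : T, p <= q -> Q q -> Q p.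

Definition subcomplex (S : Type) (Q : set (simplex S)) : Prop :=
  closed_subposet Q.

Definition cone (d : Order.disp_t) (P : porderType d) (p : P) : set P :=
  [set q | q <= p].

Definition poset_iso (d d' : Order.disp_t) (P : porderType d)
    (Q : porderType d') : Prop :=
  exists2 f : P -> Q, bijective f & {mono f : x y / x <= y}.

Definition conditionally_complete (d : Order.disp_t) (P : porderType d) : Prop :=
  forall A : set P, A !=set0 -> has_ubound A -> exists m : P, isLub A m.

Definition simplicial (d : Order.disp_t) (P : porderType d) : Prop :=
  conditionally_complete P /\
  forall p : P, exists S : Type, poset_iso (subposet (cone p)) (simplex S).

(* Main.v *)
Require Import Defs.
From mathcomp Require Import all_boot all_order all_classical.

Import Order.TTheory.
Local Open Scope order_scope.
Local Open Scope classical_set_scope.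

(** A simplicial poset is recovered from its minimal elements, its vertices:
    sending an element to the set of vertices below it realizes the poset as a
    family of nonempty sets closed under nonempty subsets.  Inside the cone of
    one element [p] this is read off the isomorphism with a simplex, where the
    vertices are the singletons ([cone_vertices]).  Only the comparison of two
    elements [p] and [q] that lie in no common cone is not local, and this is
    where conditional completeness enters: if every vertex of [p] lies below
    [q], then the vertices of [p] are bounded by both [p] and [q], so their
    least upper bound [m] is below both; but [m] lies in the cone of [p] and has
    all the vertices of [p], so [m = p] and [p <= q] ([vertices_le]).

    Conversely, in a family of nonempty sets closed under nonempty subsets, the
    union of a bounded nonempty subfamily belongs to the family and is its
    least upper bound, and the members below [X] are all the nonempty subsets
    of [X].

    Both directions pass through [simplicial_labelling], which presents a
    subcomplex as a set-valued map on the abstract poset and so avoids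
    transporting cones and bounds along an isomorphism. *)

(** An isomorphism onto a subcomplex, composed with the inclusion into the
    sets of vertices. *)
Definition simplicial_labelling {d : Order.disp_t} {P : porderType d}
    {S : Type} (F : P -> set S) : Prop :=
  [/\ forall p q : P, p <= q <-> F p `<=` F q,
      forall p : P, F p !=set0
    & forall (p : P) (A : set S), A !=set0 -> A `<=` F p ->
        exists q : P, F q = A].

Lemma surj_poset_iso {d d' : Order.disp_t} {P : porderType d}
    {Q : porderType d'} {f : P -> Q} :
  {mono f : x y / x <= y} -> (forall y, exists x, f x = y) -> poset_iso P Q.
Proof.
move=> fle fsurj; exists f => //.
have [g gK] := boolp.choice fsurj.
by exists g => // x; apply: (inc_inj fle); rewrite gK.
Qed.

Lemma subposet_le {d : Order.disp_t} {T : porderType d} {A : set T}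
    (x y : subposet A) :
  (x <= y) = (val x <= val y).
Proof. by rewrite Order.le_val. Qed.

Lemma simplex_le {S : Type} (a b : simplex S) :
  a <= b <-> val a `<=` val b.
Proof. by rewrite subposet_le subsetEset. Qed.

Lemma subposet_in {d : Order.disp_t} {T : porderType d} {A : set T}
    (x : subposet A) : A (val x).
Proof. exact: set_mem (valP x). Qed.

Definition subposet_mk {d : Order.disp_t} {T : porderType d} {A : set T}
  {x : T} (Ax : A x) : subposet A := Sub x (mem_set Ax).

Section LabellingToSimplicial.

Context {d : Order.disp_t} {P : porderType d} {S : Type} {F : P -> set S}.
Hypothesis labF : simplicial_labelling F.

Lemma labelling_conditionally_complete : conditionally_complete P.
Proof.
have [Fle F0 Fdown] := labF.
move=> A [a Aa] [p pA].
have [||m Fm] := Fdown p (\bigcup_(x in A) F x).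
- by have [s Fas] := F0 a; exists s, a.
- by apply: bigcup_sub => x /pA /Fle.
exists m; split=> [x Ax|q qA]; apply/Fle; rewrite Fm.
- exact: bigcup_sup.
- by apply: bigcup_sub => x /qA /Fle.
Qed.

(** An element of the cone is determined by its label, which is a nonempty
    subset of [F p], and every such subset is a label.  The isomorphism views
    the label of an element as a subset of the type of elements of [F p]. *)
Lemma labelling_cone_iso (p : P) :
  poset_iso (subposet (cone p)) (simplex (set_type (F p))).
Proof.
have [Fle F0 Fdown] := labF.
have trace_neq0 (x : subposet (cone p)) :
    [set s : set_type (F p) | F (val x) (val s)] !=set0.
  have [s Fxs] := F0 (val x).
  have Fps : F p s by move/Fle: (subposet_in x); apply.
  by exists (SigSub (mem_set Fps)).
apply: (surj_poset_iso (f := fun x => subposet_mk (trace_neq0 x))) => [x y|A].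
  apply/idP/idP => [/simplex_le xy|xy].
    rewrite subposet_le; apply/Fle => s Fxs.
    have Fps : F p s by move/Fle: (subposet_in x); apply.
    exact: (xy (SigSub (mem_set Fps)) Fxs).
  by apply/simplex_le => s /=; move: xy; rewrite subposet_le => /Fle; apply.
have [||q Fq] := Fdown p (val @` val A).
- by have [s As] := subposet_in A; exists (val s), s.
- by move=> _ [s _ <-]; exact: set_mem (valP s).
have qp : cone p q.
  by apply/Fle; rewrite Fq => _ [s _ <-]; exact: set_mem (valP s).
exists (subposet_mk qp); apply: val_inj => /=.
rewrite Fq; apply/seteqP; split=> [s [t At /val_inj <-//]|s As].
by exists s.
Qed.

Lemma labelling_simplicial : simplicial P.
Proof.
split; first exact: labelling_conditionally_complete.
by move=> p; exists (set_type (F p)); exact: labelling_cone_iso.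
Qed.

End LabellingToSimplicial.

Definition vertices {d : Order.disp_t} {P : porderType d} (p : P) : set P :=
  [set a | a <= p /\ forall b, b <= a -> b = a].

(** In the simplex isomorphic to the cone of [p], vertices are singletons:
    they are minimal in [P], not just in the cone, because the cone is closed
    downwards.  The three conclusions are then the corresponding facts about
    the nonempty subsets of [S]. *)
Lemma cone_vertices {d : Order.disp_t} {P : porderType d} {p : P} {S : Type} :
  poset_iso (subposet (cone p)) (simplex S) ->
  [/\ vertices p !=set0,
      forall q r, q <= p -> r <= p -> vertices q `<=` vertices r -> q <= r
    & forall A, A !=set0 -> A `<=` vertices p -> exists q, vertices q = A].
Proof.
move=> [f [g fK gK] fle].
have f_sub (x y : subposet (cone p)) : val x <= val y <-> val (f x) `<=` val (f y).
  by rewrite -subposet_le -fle; exact: simplex_le.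
have set1_neq0 (s : S) : [set A | A !=set0] [set s] by exists s.
(* The element of the cone matching the singleton of [s]. *)
pose v s := g (subposet_mk (set1_neq0 s)).
have v_le s x : val (v s) <= val x <-> val (f x) s.
  rewrite f_sub gK /=; split=> [|fxs _ ->//]; exact.
have v_vertex s : vertices p (val (v s)).
  split=> [|b bv]; first exact: subposet_in (v s).
  have bp : cone p b := le_trans bv (subposet_in (v s)).
  apply/le_anti; rewrite bv; apply/(v_le s (subposet_mk bp)).
  have [t fbt] := subposet_in (f (subposet_mk bp)).
  have /f_sub := (bv : val (subposet_mk bp) <= val (v s)).
  by rewrite gK => /(_ t fbt) <-.
have vertexP a : vertices p a -> exists s, a = val (v s).
  move=> [ap amin]; pose a' : subposet (cone p) := subposet_mk (ap : cone p a).
  have [s fas] := subposet_in (f a').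
  by exists s; rewrite -(amin (val (v s))) //; apply/(v_le s a').
have verticesW q a : q <= p -> vertices q a -> vertices p a.
  by move=> qp [aq amin]; split=> //; exact: le_trans aq qp.
split.
- have [s _] := subposet_in (f (subposet_mk (lexx p : cone p p))).
  by exists (val (v s)).
- move=> q r qp rp qr.
  apply/(f_sub (subposet_mk (qp : cone p q)) (subposet_mk (rp : cone p r))) => s.
  move=> /v_le vq; apply/v_le; apply: (qr _ _).1; split=> //.
  exact: (v_vertex s).2.
- move=> A [a Aa] Ap.
  have U0 : [set A | A !=set0] [set s | A (val (v s))].
    by have [s a_v] := vertexP a (Ap a Aa); exists s; rewrite /= -a_v.
  (* The element matching the set of all [s] whose vertex [v s] is in [A]. *)
  have gUp := subposet_in (g (subposet_mk U0)).
  exists (val (g (subposet_mk U0))); apply/seteqP; split=> b.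
    move=> vb; have [s b_v] := vertexP b (verticesW _ _ gUp vb).
    by move: vb.1; rewrite b_v => /v_le; rewrite gK.
  move=> Ab; have [s b_v] := vertexP b (Ap b Ab).
  split; last exact: (Ap b Ab).2.
  by rewrite b_v; apply/v_le; rewrite gK /= -b_v.
Qed.

Section SimplicialToLabelling.

Context {d : Order.disp_t} {P : porderType d}.
Hypothesis simpP : simplicial P.

(** The vertices below [p] also determine the comparison with an element [q]
    outside the cone of [p]: their least upper bound lies below [q], and it is
    [p] itself because the cone of [p] is a simplex. *)
Lemma vertices_le (p q : P) : p <= q <-> vertices p `<=` vertices q.
Proof.
split=> [pq a [ap amin]|pq]; first by split=> //; exact: le_trans ap pq.
have [S isoS] := simpP.2 p.
have [vp0 vp_le _] := cone_vertices isoS.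
have p_ub : ubound (vertices p) p by move=> a [].
have [|m [m_ub m_least]] := simpP.1 (vertices p) vp0; first by exists p.
have pm : p <= m.
  apply: vp_le => //; first exact: m_least.
  by move=> a va; split; [exact: m_ub | exact: va.2].
by apply: le_trans pm (m_least q _) => a /pq [].
Qed.

Lemma simplicial_vertices_labelling : simplicial_labelling (@vertices d P).
Proof.
split; first exact: vertices_le.
  by move=> p; have [S /cone_vertices[]] := simpP.2 p.
by move=> p; have [S /cone_vertices[_ _]] := simpP.2 p.
Qed.

End SimplicialToLabelling.

Lemma labelling_subcomplex {d : Order.disp_t} {P : porderType d} {S : Type}
    {F : P -> set S} :
  simplicial_labelling F ->
  exists Q : set (simplex S), subcomplex Q /\ poset_iso P (subposet Q).
Proof.
move=> [Fle F0 Fdown].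
pose G p : simplex S := subposet_mk (F0 p : [set A | A !=set0] (F p)).
exists (range G); split.
  move=> A B /simplex_le AB [p _ GpB]; move: AB; rewrite -GpB => AFp.
  have [q Fq] := Fdown p (val A) (subposet_in A) AFp.
  by exists q => //; exact: val_inj.
apply: (surj_poset_iso (f := fun p => subposet_mk (imageT G p))) => [p q|A].
  rewrite subposet_le; apply/idP/idP => [/simplex_le/Fle//|/Fle pq].
  exact/simplex_le.
by have [p _ GpA] := subposet_in A; exists p; exact: val_inj.
Qed.

Lemma subcomplex_labelling {d : Order.disp_t} {P : porderType d} {S : Type}
    {Q : set (simplex S)} :
  subcomplex Q -> poset_iso P (subposet Q) ->
  exists F : P -> set S, simplicial_labelling F.
Proof.
move=> Qdown [f [g fK gK] fle]; exists (fun p => val (val (f p))); split.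
- by move=> p q; rewrite -fle subposet_le; exact: simplex_le.
- by move=> p; exact: subposet_in (val (f p)).
move=> p A A0 Ap; pose a := subposet_mk (A0 : [set A | A !=set0] A).
have Qa : Q a by apply: Qdown (subposet_in (f p)); exact/simplex_le.
by exists (g (subposet_mk Qa)); rewrite gK.
Qed.

Theorem theorem6p10 (d : Order.disp_t) (P : porderType d) :
  simplicial P <->
  exists (S : Type) (Q : set (simplex S)),
    subcomplex Q /\ poset_iso P (subposet Q).
Proof.
split=> [/simplicial_vertices_labelling/labelling_subcomplex PQ|].
  by exists P.
move=> [S [Q [Qdown /(subcomplex_labelling Qdown)[F]]]].
exact: labelling_simplicial.
Qed.
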